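(* Let $D$ be a Prüfer domain. Then the following are equivalent: (i) $D$ is min-scattered; (ii) every radical semistar operation on $D$ is spectral; (iii) $\star=\widehat{\star}$ for every stable semistar operation $\star$ on $D$.
   Context: Let $D$ be an integral domain with quotient field $K$ and let $\mathbf{F}(D)$ be the set of $D$-submodules of $K$. A semistar operation on $D$ is a map $\star:\mathbf{F}(D)\to\mathbf{F}(D)$, $I\mapsto I^\star$, such that for all $I,J\in\mathbf{F}(D)$ and $x\in K$: $I\subseteq I^\star$; if $I\subseteq J$ then $I^\star\subseteq J^\star$; $(I^\star)^\star=I^\star$; $(xI)^\star=x\cdot I^\star$. A semistar operation $\star$ is stable if $(I\cap J)^\star=I^\star\cap J^\star$ for all $I,J\in\mathbf{F}(D)$. It is quasi-radical if, for every ideal $I$ of $D$, $1\notin I^\star$ implies $1\notin\mathrm{rad}(I)^\star$. It is radical if it is quasi-radical and stable. It is spectral if there is $\Delta\subseteq\mathrm{Spec}(D)$ such that $I^\star=\bigcap_{P\in\Delta}ID_P$ for every $I\in\mathbf{F}(D)$. The quasi-spectrum $\mathrm{QSpec}^\star(D)$ is the set of prime ideals $P$ of $D$ with $P=P^\star\cap D$. For $D$ Prüfer, the pseudo-spectrum $\mathrm{PsSpec}^\star(D)$ is the set of prime ideals $Q$ of $D$ such that $1\in Q^\star$ but there is a $Q$-primary ideal $L$ with $L=L^\star\cap D$. The normalized stable version $\widehat{\star}$ of $\star$ is the semistar operation $$\widehat{\star}:I\mapsto\bigcap_{P\in\mathrm{QSpec}^\star(D)}ID_P\cap\bigcap_{Q\in\mathrm{PsSpec}^\star(D)}(ID_Q)^{v_Q},$$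 where $v_Q$ is the $v$-operation on the valuation domain $D_Q$, i.e. $J^{v_Q}=(D_Q:(D_Q:J))$ for each $D_Q$-submodule $J$ of $K$, with $(A:B)=\{x\in K\mid xB\subseteq A\}$. Empty intersections are $K$. For an ideal $I$ of $D$, $\mathrm{Min}(I)$ is the set of minimal primes of $I$, with the subspace topology of the Zariski topology. For a topological space $X$, $\mathcal{D}(X)$ is the set of non-isolated points of $X$; $\mathcal{D}^0(X)=X$, $\mathcal{D}^{\gamma+1}(X)=\mathcal{D}(\mathcal{D}^\gamma(X))$ and $\mathcal{D}^\alpha(X)=\bigcap_{\beta<\alpha}\mathcal{D}^\beta(X)$ for limit $\alpha$. $X$ is scattered if $\mathcal{D}^\alpha(X)=\emptyset$ for some ordinal $\alpha$. $D$ is min-scattered if $\mathrm{Min}(I)$ is scattered for every ideal $I$ of $D$. *)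

(* Defs.v *)
From HB Require Import structures.
From mathcomp Require Import all_boot all_order all_algebra.
From mathcomp Require Import all_classical.
From mathcomp Require Import wochoice topology.

Set Implicit Arguments.
Unset Strict Implicit.
Unset Printing Implicit Defensive.

Import GRing.Theory.
Local Open Scope classical_set_scope.
Local Open Scope ring_scope.

(* Throughout, the quotient field of D is K = {fraction D}; an ideal of D is a
   set D, a D-submodule of K is a set {fraction D}, and D is identified with
   its image under tofrac. *)

Definition is_ideal (D : idomainType) (I : set D) : Prop :=
  [/\ I 0, forall x y, I x -> I y -> I (x + y) & forall a x, I x -> I (a * x)].

Definition is_submodule (D : idomainType) (I : set {fraction D}) : Prop :=
  [/\ I 0, forall x y, I x -> I y -> I (x + y)
    & forall (a : D) x, I x -> I (tofrac a * x)].

(* Images of ideals in K, and the contraction J \cap D of a submodule of K. *)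
Definition ext (D : idomainType) (I : set D) : set {fraction D} :=
  @tofrac D @` I.

Definition contr (D : idomainType) (J : set {fraction D}) : set D :=
  @tofrac D @^-1` J.

Definition is_prime (D : idomainType) (P : set D) : Prop :=
  [/\ is_ideal P, ~ P 1 & forall a b, P (a * b) -> P a \/ P b].

Definition rad (D : idomainType) (I : set D) : set D :=
  [set x | exists n : nat, I (x ^+ n.+1)].

Definition is_primary (D : idomainType) (L : set D) : Prop :=
  [/\ is_ideal L, ~ L 1
    & forall a b, L (a * b) -> L a \/ exists n : nat, L (b ^+ n.+1)].

Record spec (D : idomainType) : Type := Spec {
  spec_set :> set D;
  spec_prime : is_prime spec_set }.

HB.instance Definition _ (D : idomainType) := gen_eqMixin (spec D).
HB.instance Definition _ (D : idomainType) := gen_choiceMixin (spec D).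

Definition zariski_open (D : idomainType) : set (set (spec D)) :=
  [set U | exists S : set D, U = [set P : spec D | ~ S `<=` P]].

Lemma zariski_openT (D : idomainType) : @zariski_open D setT.
Proof.
exists setT; apply/seteqP; split=> // P _ /= sP.
by have [_ P1 _] := spec_prime P; apply/P1/sP.
Qed.

Lemma zariski_openI (D : idomainType) : setI_closed (@zariski_open D).
Proof.
move=> _ _ [S ->] [T ->].
exists [set x | exists s t, [/\ S s, T t & x = s * t]].
apply/seteqP; split=> P /=; have [[_ _ PM] _ Ppr] := spec_prime P.
- move=> [/existsNP[s /not_implyP[Ss Ps]] /existsNP[t /not_implyP[Tt Pt]]] sP.
  have : spec_set P (s * t) by apply: sP; exists s, t.
  by move=> /Ppr[].
- move=> nsP; split=> sP; apply: nsP => _ [s [t [Ss Tt ->]]].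
  + by rewrite mulrC; apply/PM/sP.
  + by apply/PM/sP.
Qed.

Lemma zariski_open_bigU (D : idomainType) (I : Type) (f : I -> set (spec D)) :
  (forall i, zariski_open (f i)) -> zariski_open (\bigcup_i f i).
Proof.
move=> /choice[S fS]; exists (\bigcup_i S i); apply/seteqP; split=> P /=.
- move=> [i _]; rewrite fS /= => nSP sP; apply: nSP => x Sx.
  by apply: sP; exists i.
- move=> /existsNP[x /not_implyP[[i _ Sx] nPx]].
  by exists i => //; rewrite fS /= => /(_ x Sx).
Qed.

HB.instance Definition _ (D : idomainType) :=
  isOpenTopological.Build (spec D) (@zariski_openT D) (@zariski_openI D)
    (@zariski_open_bigU D).

Definition min_primes (D : idomainType) (I : set D) : set (spec D) :=
  [set P | I `<=` P /\
    forall Q : spec D, I `<=` Q -> Q `<=` P -> Q = P :> set D].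

(* Non-isolated points of X, for the subspace topology. *)
Definition derived (T : topologicalType) (X : set T) : set T :=
  X `\` isolated X.

(* Ordinals are represented by the elements of well-ordered types: w stands for
   the order type of its strict initial segment. *)
Section Ordinals.
Variables (W : Type) (R : rel W).

Definition below (v w : W) : Prop := R v w /\ v <> w.

Definition is_zero (w : W) : Prop := forall v, ~ below v w.

Definition is_succ (v w : W) : Prop :=
  below v w /\ forall u, below v u -> R w u.

Definition is_limit (w : W) : Prop :=
  ~ is_zero w /\ forall v, ~ is_succ v w.

Definition is_derived_sequence (T : topologicalType) (X : set T)
    (d : W -> set T) : Prop :=
  [/\ forall w, is_zero w -> d w = X,
      forall v w, is_succ v w -> d w = derived (d v)
    & forall w, is_limit w -> d w = \bigcap_(v in [set v | below v w]) d v].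

End Ordinals.

Definition scattered (T : topologicalType) (X : set T) : Prop :=
  exists (W : Type) (R : rel W) (d : W -> set T),
    [/\ well_order R, is_derived_sequence R X d & exists w, d w = set0].

Definition min_scattered (D : idomainType) : Prop :=
  forall I : set D, is_ideal I -> scattered (min_primes I).

Definition mulm (D : idomainType) (A B : set {fraction D}) :
    set {fraction D} :=
  [set x | exists (n : nat) (a b : 'I_n -> {fraction D}),
    [/\ forall i, A (a i), forall i, B (b i) & x = \sum_(i < n) a i * b i]].

Definition colon (D : idomainType) (A B : set {fraction D}) :
    set {fraction D} :=
  [set x | [set x * y | y in B] `<=` A].

Definition loc (D : idomainType) (P : set D) : set {fraction D} :=
  [set x | exists a s : D, ~ P s /\ x = tofrac a / tofrac s].

Definition ideal_span (D : idomainType) (n : nat) (a : 'I_n -> D) : set D :=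
  [set x | exists c : 'I_n -> D, x = \sum_(i < n) c i * a i].

Definition invertible (D : idomainType) (I : set {fraction D}) : Prop :=
  exists2 J : set {fraction D}, is_submodule J & mulm I J = ext [set: D].

Definition is_prufer (D : idomainType) : Prop :=
  forall (n : nat) (a : 'I_n -> D),
    ideal_span a != [set 0] -> invertible (ext (ideal_span a)).

(* A semistar operation is a map on the submodules of K; only the values of
   star on submodules are meaningful. *)
Record is_semistar (D : idomainType)
    (star : set {fraction D} -> set {fraction D}) : Prop := {
  semistar_submodule : forall I, is_submodule I -> is_submodule (star I);
  semistar_ext : forall I, is_submodule I -> I `<=` star I;
  semistar_mono : forall I J, is_submodule I -> is_submodule J ->
    I `<=` J -> star I `<=` star J;
  semistar_idem : forall I, is_submodule I -> star (star I) = star I;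
  semistar_scale : forall (x : {fraction D}) I, is_submodule I ->
    star [set x * y | y in I] = [set x * y | y in star I] }.

Section SemistarProperties.
Variables (D : idomainType) (star : set {fraction D} -> set {fraction D}).

Definition is_stable : Prop :=
  forall I J, is_submodule I -> is_submodule J ->
    star (I `&` J) = star I `&` star J.

Definition is_quasi_radical : Prop :=
  forall I : set D, is_ideal I ->
    ~ star (ext I) 1 -> ~ star (ext (rad I)) 1.

Definition is_radical : Prop := is_quasi_radical /\ is_stable.

Definition is_spectral : Prop :=
  exists Delta : set (spec D), forall I, is_submodule I ->
    star I = \bigcap_(P in Delta) mulm I (loc P).

Definition quasi_spec : set (spec D) :=
  [set P | (P : set D) = contr (star (ext P))].

Definition pseudo_spec : set (spec D) :=
  [set Q | star (ext Q) 1 /\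
    exists L : set D,
      [/\ is_primary L, rad L = Q & L = contr (star (ext L))]].

End SemistarProperties.

Definition v_op (D : idomainType) (A J : set {fraction D}) :
    set {fraction D} :=
  colon A (colon A J).

Definition normalized_stable (D : idomainType)
    (star : set {fraction D} -> set {fraction D}) (I : set {fraction D}) :
    set {fraction D} :=
  (\bigcap_(P in quasi_spec star) mulm I (loc P)) `&`
  (\bigcap_(Q in pseudo_spec star) v_op (loc Q) (mulm I (loc Q))).

(* Main.v *)
Require Import Defs.
From mathcomp Require Import all_boot all_algebra all_classical.
From mathcomp Require Import wochoice topology ring zify.

(* A stable semistar operation is determined by its localizing system, the set
   of ideals A with 1 in A^*: an element x lies in I^* iff the ideal (I : x)
   belongs to it.

   (i) => (ii). Let J = J^* \cap D be a proper radical ideal and Q an isolated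
   minimal prime of J, cut out by f. Then f Q is contained in J, so 1 in Q^*
   would put f in J, inside Q. Hence some prime over J is outside the
   localizing system.

   (ii) => (iii). If x were in the normalization of I but not in I^*, let J be
   the closure of (I : x). Every minimal prime Q of J, and its primary ideal
   J D_Q \cap D, would belong to the localizing system. The ideals A such that
   each x outside J has a multiple x y outside J with A + (J : x y) = D form
   another localizing system. It is radical, omits J and, D being Pruefer,
   contains all primes over J; so its operation is radical and not spectral.

   (iii) => (i). A radical operation has empty pseudo-spectrum, so (iii) makes
   it spectral. If Min(I) is not scattered, it contains a nonempty subspace Y
   without isolated points, and the ideals A such that V(A) \cap Y is nowhere
   dense in Y form a radical localizing system; it omits the intersection
   of Y but contains every minimal prime of I. *)

Set Implicit Arguments.
Unset Strict Implicit.
Unset Printing Implicit Defensive.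

Import Defs GRing.Theory.
Local Open Scope classical_set_scope.
Local Open Scope ring_scope.

(** * Well-orders and scattered spaces *)

Section WellOrder.
Variables (W : Type) (R : rel W).
Hypothesis woR : well_order R.

Lemma well_order_min (A : set W) :
  A !=set0 -> exists2 z, A z & forall x, A x -> R z x.
Proof.
move=> [x Ax]; have [|z [[zA lbz] _]] := @woR (fun x => `[<A x>]).
  by exists x; apply/asboolP.
exists z; first exact/asboolP.
by move=> y Ay; apply: lbz; apply/asboolP.
Qed.

Lemma well_order_refl x : R x x.
Proof.
by have [|z -> h] := @well_order_min [set x]; [exists x | exact: h].
Qed.

(** Minima are unique in [well_order], and [x] and [y] would both be minima of their pair. *)
Lemma well_order_anti x y : R x y -> R y x -> x = y.
Proof.
move=> Rxy Ryx; have [|z [_ zu]] := @woR (fun z => `[<z = x \/ z = y>]).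
  by exists x; apply/asboolP; left.
have minx : minimum_of R (fun z => `[<z = x \/ z = y>]) x.
  split; first by apply/asboolP; left.
  by move=> _ /asboolP[->|->] //; apply: well_order_refl.
have miny : minimum_of R (fun z => `[<z = x \/ z = y>]) y.
  split; first by apply/asboolP; right.
  by move=> _ /asboolP[->|->] //; apply: well_order_refl.
by rewrite -(zu x minx) (zu y miny).
Qed.

Lemma below_total x y : x <> y -> below R x y \/ below R y x.
Proof.
move=> xy; have [|z zxy h] := @well_order_min [set x; y];
  first by exists x; left.
case: zxy h => -> h; [left|right]; split=> //; last exact/nesym.
- by apply: h; right.
- by apply: h; left.
Qed.

Lemma below_wf : well_founded (below R).
Proof.
move=> w; apply: contrapT => nw.
have [z nz hz] : exists2 z, ~ Acc (below R) z &
    forall x, ~ Acc (below R) x -> R z x.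
  by apply: (@well_order_min [set w | ~ Acc (below R) w]); exists w.
apply: nz; constructor => v [Rvz vz]; apply: contrapT => /hz Rzv.
exact/vz/well_order_anti.
Qed.

Lemma succ_exists v w : below R v w -> exists s, is_succ R v s.
Proof.
move=> vw; have [|s vs h] := @well_order_min [set s | below R v s].
  by exists w.
by exists s; split=> // u; apply: h.
Qed.

End WellOrder.

Lemma cantor_powerset (T : Type) (f : set T -> T) : ~ injective f.
Proof.
move=> fI; pose A := [set x | exists2 B, f B = x & ~ B x].
suff [h1 h2] : A (f A) <-> ~ A (f A) by have nA := fun a => h1 a a; exact/nA/h2.
by split=> [[B /fI -> //]|nA]; exists A.
Qed.

Section Scattered.
Variable T : topologicalType.
Implicit Types X Y : set T.

(** Without isolated points [derived X = X], so by transfinite induction every term of the sequence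
    is [X]. *)
Lemma scattered_isolated X : scattered X -> X !=set0 -> exists p, isolated X p.
Proof.
move=> [W [R [d [woR [d0 dS dL] [w dw]]]]] [x Xx]; apply: contrapT => noiso.
have derX : derived X = X.
  by apply/seteqP; split=> [p []//|p Xp]; split=> // ip; apply: noiso; exists p.
suff dX : forall v, d v = X by move: Xx; rewrite -(dX w) dw.
elim/(well_founded_ind (below_wf woR)) => v IH.
have [/d0//|nz] := pselect (is_zero R v).
have [[u uv]|ns] := pselect (exists u, is_succ R u v).
  by rewrite (dS _ _ uv) IH //; case: uv.
rewrite dL; last by split=> // u uv; apply: ns; exists u.
apply/seteqP; split=> [p h|p Xp u /= uv]; last by rewrite IH.
have [u /contrapT uv] := (existsNP _).2 nz.
by rewrite -(IH u uv); apply: h.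
Qed.

(** Well-founded recursion with one formula for all three cases: [d w] collects the points of [X]
    that lie in [derived (d v)] for every earlier [v]. *)
Lemma derived_sequence_exists (W : Type) (R : rel W) X : well_order R ->
  exists2 d : W -> set T, is_derived_sequence R X d &
    forall v w, below R v w -> d w `<=` derived (d v).
Proof.
move=> woR; have wf := below_wf woR.
pose F w (g : forall v, below R v w -> set T) : set T :=
  [set p | X p /\ forall v vw, derived (g v vw) p].
pose d := Fix wf (fun=> set T) F.
have dE w : d w = [set p | X p /\ forall v, below R v w -> derived (d v) p].
  rewrite /d Fix_eq // => v f g fg; apply/seteqP.
  by split=> p [Xp h]; split=> // u uv; [rewrite -fg|rewrite fg]; apply: h.
have ddec v w : below R v w -> d w `<=` derived (d v).
  by move=> vw; rewrite [in X in X `<=` _]dE => p [_ /(_ v vw)].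
exists d => //; split=> [w w0|v w [vw vw']|w [nz ns]].
- rewrite dE; apply/seteqP; split=> [p []//|p Xp]; split=> // v vw.
  by case: (w0 v).
- apply/seteqP; split; first exact: ddec.
  move=> p dp; rewrite dE; split; first by case: dp; rewrite dE => -[].
  move=> u uw; have [->//|uv] := pselect (u = v).
  have [/ddec|vu] := below_total woR uv; first by apply; case: dp.
  by case: uw => Ruw []; apply: (well_order_anti woR Ruw); apply: vw'.
- apply/seteqP; split=> [p dp v /= vw|p h].
    by have [] := ddec v w vw p dp.
  rewrite dE; split=> [|v vw].
    have [v /contrapT vw] := (existsNP _).2 nz.
    by move: (h v vw); rewrite dE => -[].
  (* As [w] is a limit, the successor [s] of [v] is still below [w], and [d s] lies in
     [derived (d v)]. *)
  have [s sv] := succ_exists woR vw.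
  have [sw|] := pselect (s = w); first by case: (ns v); rewrite -sw.
  move=> /(below_total woR)[sw|ws]; first by apply: ddec (h s sw); case: sv.
  by case: ws => Rws []; apply: (well_order_anti woR Rws); case: sv => _; apply.
Qed.

(** If no [d w] is empty, choose an isolated point [p w] of each. It is missing from all later
    terms, so [p] is injective; as the indices are well-ordered elements of [set T], this
    contradicts Cantor. *)
Lemma isolated_scattered X :
  (forall Y, Y `<=` X -> Y !=set0 -> exists p, isolated Y p) -> scattered X.
Proof.
move=> isoX; have [R woR] := well_ordering_principle (set T).
have [d dX ddec] := derived_sequence_exists X woR.
exists (set T), R, d; split=> //; apply: contrapT => dn0.
have dSX w : d w `<=` X.
  have [|z _ hz] := @well_order_min _ _ woR setT; first by exists set0.
  have z0 : is_zero R z by move=> v [Rvz []]; apply: (well_order_anti woR Rvz);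
    apply: hz.
  have [<-|/(below_total woR)[]] := pselect (z = w); last by move/z0.
    by case: dX => /(_ _ z0) -> _ _ p.
  by move=> /ddec h p /h [dp _]; case: dX dp => /(_ _ z0) ->.
have /choice[p isop] : forall w, exists p, isolated (d w) p.
  move=> w; apply: isoX; first exact: dSX.
  by apply/set0P/eqP => dw; apply: dn0; exists w.
apply: (@cantor_powerset _ p) => v w pvw; apply: contrapT.
have disj u u' : p u = p u' -> ~ below R u u'.
  move=> puu' /ddec h; have [+ _] := isop u'; move=> /set_mem /h [_].
  by rewrite -puu'; apply.
by move=> /(below_total woR)[]; apply: disj.
Qed.

End Scattered.

(** * Prime ideals *)

(** Zorn's lemma also tests the empty chain, while the hypothesis covers nonempty ones; adjoining
    [B] to each chain bridges the gap. *)
Lemma Zorn_above (T : Type) (B : set T) (P : set (set T)) : P B ->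
    (forall F : set (set T), F !=set0 -> F `<=` P -> total_on F subset ->
      P (\bigcup_(X in F) X)) ->
  exists A, [/\ P A, B `<=` A & forall C, A `<=` C -> P C -> C `<=` A].
Proof.
move=> PB PF; have [|A [PA maxA]] := @Zorn_bigcup T [set X | P (X `|` B)].
  move=> F FP Ftot /=.
  have -> : \bigcup_(X in F) X `|` B =
      \bigcup_(X in [set B] `|` [set X `|` B | X in F]) X.
    apply/seteqP; split=> [x [[X FX Xx]|Bx]|x [X [->|[Y FY <-] [Yx|]]]].
    - by exists (X `|` B); [right; exists X|left].
    - by exists B; [left|].
    - by right.
    - by left; exists Y.
    - by right.
  apply: PF => [|X [->//|[Y FY <-]]|X Y]; first by exists B; left.
    exact: FP.
  move=> [->|[X' FX <-]] [->|[Y' FY <-]].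
  - by left.
  - by left=> x Bx; right.
  - by right=> x Bx; right.
  - by have [h|h] := Ftot _ _ FX FY; [left|right]; apply: setSU.
exists (A `|` B); split=> //.
move=> C AC PC; apply: contrapT => nCA; apply: (maxA C); last first.
  by rewrite /= setUidl // => x Bx; apply: AC; right.
split=> [x Ax|CA]; first by apply: AC; left.
by apply: nCA => x /CA; left.
Qed.

Section Ideals.
Variable D : idomainType.
Implicit Types (A J L : set D) (P Q : spec D).

Lemma ideal_mull A a x : is_ideal A -> A a -> A (a * x).
Proof. by move=> [_ _ AM] Aa; rewrite mulrC; apply: AM. Qed.

Lemma spec_ideal P : is_ideal P. Proof. by case: (spec_prime P). Qed.

Lemma spec_neq1 P : ~ spec_set P 1. Proof. by case: (spec_prime P). Qed.

Lemma specM P a b : ~ spec_set P a -> ~ spec_set P b -> ~ spec_set P (a * b).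
Proof. by move=> Pa Pb; case: (spec_prime P) => _ _ h /h[]. Qed.

Lemma spec_exp P a n : spec_set P (a ^+ n) -> spec_set P a.
Proof.
elim: n => [/spec_neq1//|n IH]; rewrite exprS.
by case: (spec_prime P) => _ _ h /h[].
Qed.

Lemma spec_inj P Q : P = Q :> set D -> P = Q.
Proof.
case: P Q => [P pP] [Q pQ] /= PQ; rewrite PQ in pP *.
by congr Spec; apply: Prop_irrelevance.
Qed.

Lemma bigcup_chain_ideal (F : set (set D)) :
  F !=set0 -> F `<=` @is_ideal D -> total_on F subset ->
  is_ideal (\bigcup_(X in F) X).
Proof.
move=> [X0 FX0] FI Ftot; split.
- by exists X0 => //; case: (FI _ FX0).
- move=> x y [X FX Xx] [Y FY Yy]; have [h|h] := Ftot _ _ FX FY.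
    by exists Y => //; case: (FI _ FY) => _ YD _; apply: YD => //; apply: h.
  by exists X => //; case: (FI _ FX) => _ XD _; apply: XD => //; apply: h.
- by move=> a x [X FX Xx]; exists X => //; case: (FI _ FX) => _ _; apply.
Qed.

(** An ideal maximal among those over [J] and disjoint from [S] is prime. *)
Lemma prime_avoiding J (S : set D) : is_ideal J -> S 1 ->
    (forall a b, S a -> S b -> S (a * b)) -> J `&` S = set0 ->
  exists2 P : spec D, J `<=` P & (P : set D) `&` S = set0.
Proof.
move=> idJ S1 SM JS.
have [//|F F0 FP Ftot|M [[idM MS] JM Mmax]] :=
  @Zorn_above D J [set X | is_ideal X /\ X `&` S = set0].
  split; first by apply: bigcup_chain_ideal => // X /FP[].
  apply/seteqP; split=> // x [[X /FP[_ XS] Xx] Sx].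
  by rewrite -XS; split.
have [M0 MD MM] := idM.
have key a : ~ M a -> exists m c, M m /\ S (m + c * a).
  move=> Ma; apply: contrapT => nS; apply: Ma.
  apply: (Mmax [set x | exists m c, M m /\ x = m + c * a]).
  - by move=> m Mm; exists m, 0; split=> //; ring.
  - split; last first.
      apply/seteqP; split=> // _ [[m [c [Mm ->]]] Sm].
      by apply: nS; exists m, c.
    split.
    + by exists 0, 0; split=> //; ring.
    + move=> _ _ [m [c [Mm ->]]] [m' [c' [Mm' ->]]].
      by exists (m + m'), (c + c'); split; [apply: MD|ring].
    + move=> x _ [m [c [Mm ->]]].
      by exists (x * m), (x * c); split; [apply: MM|ring].
  - by exists 0, 1; split=> //; ring.
have prM : is_prime M.
  split=> // [M1|a b Mab]; first by rewrite -[False]/(set0 (1 : D)) -MS.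
  apply: contrapT => /not_orP[/key[m [c [Mm Sm]]] /key[m' [c' [Mm' Sm']]]].
  rewrite -[False]/(set0 ((m + c * a) * (m' + c' * b))) -MS.
  split; last exact: SM.
  have -> : (m + c * a) * (m' + c' * b) =
    (m' + c' * b) * m + (c * a * m' + c * c' * (a * b)) by ring.
  by apply: (MD); [|apply: (MD)]; apply: MM.
by exists (Spec prM).
Qed.

(** Zorn's lemma goes upwards, so it is applied to complements of primes; the union of a chain of
    these is again one. *)
Lemma min_prime_below J P : J `<=` P -> exists2 Q, min_primes J Q & Q `<=` P.
Proof.
move=> JP.
have [||A [[prA JA] PA Amax]] := @Zorn_above D (~` (P : set D))
  [set X | is_prime (~` X) /\ J `<=` ~` X].
- by rewrite /= setCK; split=> //; apply: spec_prime.
- move=> F [X0 FX0] FP Ftot; split; last first.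
    by move=> x Jx [X /FP[_ /(_ _ Jx)]].
  split; last 2 first.
  + by move=> h; case: (FP _ FX0) => -[_ + _ _]; apply=> X0h; apply: h;
      exists X0.
  + move=> a b nab; apply: contrapT => /not_orP[/contrapT[X FX Xa]].
    move=> /contrapT[Y FY Yb]; apply: nab.
    have [h|h] := Ftot _ _ FX FY.
      exists Y => //; apply: contrapT => nY.
      by have [[_ _ /(_ _ _ nY) nab] _] := FP _ FY; case: nab; apply=> //;
        apply: h.
    exists X => //; apply: contrapT => nX.
    by have [[_ _ /(_ _ _ nX) nab] _] := FP _ FX; case: nab; apply=> //;
      apply: h.
  + split=> [[X /FP[[[+ _ _] _ _] _]]//|x y nx ny|a x nx] [X FX].
      have [[[_ XD _] _ _] _] := FP _ FX.
      by apply: XD => ?; [apply: nx|apply: ny]; exists X.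
    have [[[_ _ XM] _ _] _] := FP _ FX.
    by apply: XM => ?; apply: nx; exists X.
exists (Spec prA) => /=; last by move=> x /= nAx; apply: contrapT => /PA.
split=> //= Q JQ QA; apply/seteqP; split=> // x nAx; apply: contrapT => Qx.
apply/nAx/(Amax (~` (Q : set D))) => //.
  by move=> y Ay Qy; apply: (QA _ Qy).
by rewrite /= setCK; split=> //; apply: spec_prime.
Qed.

Lemma proper_min_prime J : is_ideal J -> ~ J 1 -> min_primes J !=set0.
Proof.
move=> idJ J1; have [|a b -> ->||P JP _] := @prime_avoiding J [set 1] idJ.
- by [].
- by rewrite /= mulr1.
- by apply/seteqP; split=> // x [Jx /= x1]; apply: J1; rewrite -x1.
- by have [Q] := min_prime_below JP; exists Q.
Qed.

(** A prime over [J] that avoids all [s * q ^+ n] would lie inside [Q], hence equal [Q] by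
    minimality and contain [q]. *)
Lemma min_prime_power J Q q : is_ideal J -> min_primes J Q -> spec_set Q q ->
  exists s n, ~ spec_set Q s /\ J (s * q ^+ n.+1).
Proof.
move=> idJ [JQ Qmin] Qq; apply: contrapT => npow.
have [|||P JP PS] :=
  @prime_avoiding J [set x | exists s n, ~ spec_set Q s /\ x = s * q ^+ n] idJ.
- by exists 1, 0; split; [exact: spec_neq1|rewrite expr0 mulr1].
- move=> a b [s [n [Qs aE]]] [t [m [Qt bE]]]; rewrite aE bE;
    exists (s * t), (n + m)%N.
  by split; [apply: specM|rewrite exprD; ring].
- apply/seteqP; split=> // x [Jx [s [n [Qs xE]]]]; rewrite {}xE in Jx.
  by apply: npow; exists s, n; split=> //; rewrite exprSr mulrA;
    apply: ideal_mull.
have dis x : spec_set P x -> ~ exists s n, ~ spec_set Q s /\ x = s * q ^+ n.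
  by move=> Px h; rewrite -[False]/(set0 x) -PS; split.
have PQ : P `<=` Q.
  move=> x Px; apply: contrapT => Qx; apply: (dis _ Px).
  by exists x, 0; rewrite expr0 mulr1.
apply: (dis q); first by rewrite (Qmin _ JP PQ).
by exists 1, 1; rewrite mul1r expr1; split=> //; apply: spec_neq1.
Qed.

Lemma rad_ideal J : is_ideal J -> is_ideal (rad J).
Proof.
move=> idJ; have [J0 JD JM] := idJ; split.
- by exists 0%N; rewrite expr1.
(* Each binomial term of degree [(n + m).+1] contains [x ^+ n.+1] or [y ^+ m.+1]. *)
- move=> x y [n Jx] [m Jy]; exists (n + m)%N.
  rewrite exprDn; apply: (@big_ind _ J) => // i _; rewrite -mulr_natl.
  apply/(JM)=> /=; have [mi|im] := leqP m.+1 i.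
    by apply/JM; rewrite -(subnKC mi) exprD; apply: ideal_mull.
  apply: ideal_mull => //; have -> : ((n + m).+1 - i = n.+1 + (m - i))%N by lia.
  by rewrite exprD; apply: ideal_mull.
- by move=> a x [n Jx]; exists n; rewrite exprMn; apply: JM.
Qed.

Lemma rad_spec J P : J `<=` P -> rad J `<=` P.
Proof. by move=> JP x [n /JP /spec_exp]. Qed.

Lemma radP J x : is_ideal J -> (forall P, J `<=` P -> spec_set P x) -> rad J x.
Proof.
move=> idJ allP; apply: contrapT => nx.
have [|||P JP PS] := @prime_avoiding J [set y | exists n, y = x ^+ n] idJ.
- by exists 0%N; rewrite expr0.
- by move=> a b [n aE] [m bE]; rewrite aE bE; exists (n + m)%N; rewrite exprD.
- apply/seteqP; split=> // y [Jy [n yE]]; rewrite {}yE in Jy.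
  by apply: nx; exists n; rewrite exprSr; apply: ideal_mull.
by rewrite -[False]/(set0 x) -PS; split; [exact: allP|exists 1%N;
  rewrite expr1].
Qed.

Lemma isolated_min_prime J P : isolated (min_primes J) P ->
  exists2 f, ~ spec_set P f & forall Q, min_primes J Q -> ~ spec_set Q f -> Q =
    P.
Proof.
move=> [/set_mem minP [V]]; rewrite nbhsE => -[U [[S ->] /= nSP] UV] VE.
have [f /not_implyP[Sf Pf]] := (existsNP _).2 nSP.
exists f => // Q minQ Qf; rewrite -[Q = P]/([set P] Q) -VE; split=> //.
by apply: UV => /(_ f Sf).
Qed.

End Ideals.

(** * Stable semistar operations and localizing systems *)

Section Submodules.
Variable D : idomainType.
Implicit Types (A J L : set D) (I : set {fraction D}) (P Q : spec D).

(** The ideal (I : x) of [D]; [iquot] is its analogue for an ideal and an element of [D]. *)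
Definition residual I (x : {fraction D}) : set D := [set d | I (tofrac d * x)].

Definition iquot J (a : D) : set D := [set d | J (d * a)].

Lemma extE A a : ext A (tofrac a) <-> A a.
Proof.
split=> [[b Ab /eqP]|Aa]; last by exists a.
by rewrite tofrac_eq => /eqP <-.
Qed.

Lemma ext_submodule A : is_ideal A -> is_submodule (ext A).
Proof.
move=> [A0 AD AM]; split; first by exists 0; rewrite ?tofrac0.
- by move=> _ _ [a Aa <-] [b Ab <-]; exists (a + b); rewrite ?tofracD //;
    apply: AD.
- by move=> d _ [a Aa <-]; exists (d * a); rewrite ?tofracM //; apply: AM.
Qed.

Lemma residual_ideal I x : is_submodule I -> is_ideal (residual I x).
Proof.
move=> [I0 ID IM]; split; rewrite /residual /=.
- by rewrite tofrac0 mul0r.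
- by move=> a b Ia Ib; rewrite tofracD mulrDl; apply: ID.
- by move=> a b Ib; rewrite tofracM -mulrA; apply: IM.
Qed.

Lemma contr_ideal I : is_submodule I -> is_ideal (contr I).
Proof.
move=> /(residual_ideal 1).
by congr is_ideal; apply/seteqP; split=> x; rewrite /residual /= mulr1.
Qed.

Lemma iquot_ideal J a : is_ideal J -> is_ideal (iquot J a).
Proof.
move=> [J0 JD JM]; split; rewrite /iquot /=.
- by rewrite mul0r.
- by move=> x y Jx Jy; rewrite mulrDl; apply: JD.
- by move=> x y Jy; rewrite -mulrA; apply: JM.
Qed.

Lemma idealT : is_ideal [set: D]. Proof. by []. Qed.

Lemma scale_submodule I x :
  is_submodule I -> is_submodule [set x * y | y in I].
Proof.
move=> [I0 ID IM]; split; first by exists 0; rewrite ?mulr0.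
- by move=> _ _ [a Ia <-] [b Ib <-]; exists (a + b); [apply: ID|rewrite mulrDr].
- by move=> d _ [a Ia <-]; exists (tofrac d * a); [apply: IM|rewrite mulrCA].
Qed.

Lemma setI_submodule I I' :
  is_submodule I -> is_submodule I' -> is_submodule (I `&` I').
Proof.
move=> [I0 ID IM] [I'0 I'D I'M]; split=> //.
- by move=> x y [Ix I'x] [Iy I'y]; split; [apply: ID|apply: I'D].
- by move=> a x [Ix I'x]; split; [apply: IM|apply: I'M].
Qed.

Lemma spec_tofrac_neq0 P s : ~ spec_set P s -> tofrac s != 0.
Proof.
move=> Ps; rewrite tofrac_eq0; apply/eqP => s0; apply: Ps; rewrite s0.
by case: (spec_ideal P).
Qed.

(** A finite sum has a common denominator outside [P]. *)
Lemma mulm_locP I P x : is_submodule I ->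
  mulm I (loc P) x <-> exists2 s, ~ spec_set P s & I (tofrac s * x).
Proof.
move=> [I0 ID IM]; split=> [[n [a [b [Ia Pb ->]]]]|[s Ps Isx]].
  apply: (big_ind (fun x => exists2 s, ~ spec_set P s & I (tofrac s * x))).
  - by exists 1; rewrite ?mulr0 //; apply: spec_neq1.
  - move=> y z [s Ps Iy] [t Pt Iz]; exists (s * t); first exact: specM.
    rewrite tofracM mulrDr; apply: ID; last by rewrite -mulrA; apply: IM.
    by rewrite mulrAC mulrC; apply: IM.
  - move=> i _; have [c [s [Ps ->]]] := Pb i; exists s => //.
    have -> : tofrac s * (a i * (tofrac c / tofrac s)) = tofrac c * a i.
      rewrite mulrCA [tofrac s * _]mulrC divfK 1?mulrC //.
      exact: spec_tofrac_neq0 Ps.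
    exact: IM.
exists 1%N, (fun=> tofrac s * x), (fun=> tofrac 1 / tofrac s); split=> //.
- by move=> _; exists 1, s.
- by rewrite big_ord1 tofrac1 mul1r mulrC mulKf // (spec_tofrac_neq0 Ps).
Qed.

Lemma locP P x : loc P x <->
  exists2 s, ~ spec_set P s & exists d, tofrac s * x = tofrac d.
Proof.
split=> [[d [s [Ps ->]]]|[s Ps [d sx]]].
  by exists s => //; exists d; rewrite mulrC divfK // (spec_tofrac_neq0 Ps).
by exists d, s; split=> //; rewrite -sx mulrC mulKf // (spec_tofrac_neq0 Ps).
Qed.

Lemma fraction_quotient (x : {fraction D}) :
  exists a b : D, b != 0 /\ x = tofrac a / tofrac b.
Proof.
elim/quotW: x => y; exists (frac y).1, (frac y).2; split;
  first exact: denom_ratioP.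
unlock tofrac; rewrite -[_^-1]FracField.pi_inv -[RHS]FracField.pi_mul.
rewrite /FracField.mulf /FracField.invf /= !numden_Ratio ?oner_neq0
  ?denom_ratioP //.
by rewrite mulr1 mul1r Ratio_numden.
Qed.

End Submodules.

Section Semistar.
Variables (D : idomainType) (star : set {fraction D} -> set {fraction D}).
Hypothesis starP : is_semistar star.
Implicit Types (A J L : set D) (I : set {fraction D}) (P Q : spec D).

Definition localizing A : Prop := star (ext A) 1.

Definition clos A : set D := contr (star (ext A)).

Lemma localizing_sub A B : is_ideal A -> is_ideal B -> A `<=` B ->
  localizing A -> localizing B.
Proof.
move=> idA idB AB; apply: (semistar_mono starP); try exact: ext_submodule.
exact: image_subset.
Qed.

Lemma localizingT : localizing [set: D].
Proof.
apply: (semistar_ext starP); first exact/ext_submodule/idealT.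
by exists 1; rewrite ?tofrac1.
Qed.

(* Since [1 \in A^*], one has [x \in x A^* = (x A)^*]. *)
Lemma localizing_star A I x : is_ideal A -> is_submodule I -> localizing A ->
  (forall a, A a -> I (tofrac a * x)) -> star I x.
Proof.
move=> idA smI dA AxI; have smA := ext_submodule idA.
apply: (@semistar_mono _ _ starP [set x * y | y in ext A]) => //.
- exact: scale_submodule.
- by move=> _ [_ [a Aa <-] <-]; rewrite mulrC; apply: AxI.
- by rewrite (semistar_scale starP) //; exists 1; rewrite ?mulr1.
Qed.

(** For nonzero [x] the ideal (I : x) is the intersection of x^-1 I with [D], and stability splits
    its closure. *)
Lemma star_localizing I x : is_stable star -> is_submodule I -> star I x ->
  localizing (residual I x).
Proof.
move=> stab smI Ix; have smT := ext_submodule (@idealT D).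
have [->|x0] := eqVneq x 0.
  have -> : residual I 0 = setT; last exact: localizingT.
  by apply/seteqP; split=> // d _; rewrite /residual /= mulr0; case: smI.
have smxI := scale_submodule x^-1 smI.
have E : ext (residual I x) = [set x^-1 * y | y in I] `&` ext setT.
  apply/seteqP; split=> [_ [d Id <-]|_ [[y Iy <-] [d _ dE]]].
    by split; [exists (tofrac d * x) => //; rewrite mulrC mulfK|exists d].
  by rewrite -dE; apply/extE; rewrite /residual /= dE mulrC mulrA mulfV ?mul1r.
rewrite /localizing E stab //; split; last exact: localizingT.
by rewrite (semistar_scale starP) //; exists x => //; rewrite mulVf.
Qed.

Lemma clos_ideal A : is_ideal A -> is_ideal (clos A).
Proof.
by move=> idA; apply/contr_ideal/(semistar_submodule starP)/ext_submodule.
Qed.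

Lemma sub_clos A : is_ideal A -> A `<=` clos A.
Proof.
by move=> idA a Aa; apply: (semistar_ext starP);
  [exact: ext_submodule|exists a].
Qed.

Lemma closK A : is_ideal A -> clos (clos A) = clos A.
Proof.
move=> idA; have idC := clos_ideal idA; have smA := ext_submodule idA.
apply/seteqP; split; last exact: sub_clos.
rewrite /clos => x;
  rewrite /contr /= -[in X in _ -> X](semistar_idem starP smA).
apply: (semistar_mono starP); first exact: ext_submodule.
  exact: (semistar_submodule starP).
by move=> _ [a Ca <-].
Qed.

Lemma clos1 A : clos A 1 <-> localizing A.
Proof. by rewrite /clos /contr /= tofrac1. Qed.

Lemma localizing_clos A J x : is_ideal A -> is_ideal J -> localizing A ->
  (forall a, A a -> J (a * x)) -> clos J x.
Proof.
move=> idA idJ dA AJ; apply: (localizing_star idA) => //;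
  first exact: ext_submodule.
by move=> a Aa; rewrite -tofracM; apply/extE/AJ.
Qed.

Lemma clos_localizing J x : is_stable star -> is_ideal J -> clos J x ->
  localizing (iquot J x).
Proof.
move=> stab idJ /(star_localizing stab (ext_submodule idJ)).
congr localizing; apply/seteqP.
by split=> d; rewrite /residual /iquot /= -tofracM extE.
Qed.

Lemma localizing_trans A J : is_ideal A -> is_ideal J -> localizing A ->
  A `<=` clos J -> localizing J.
Proof.
move=> idA idJ dA AJ; apply: (clos1 J).1; rewrite -closK //.
by apply: (localizing_clos idA) => //; [exact: clos_ideal|move=> a;
  rewrite mulr1; apply: AJ].
Qed.

Lemma closed_mulN A J x : is_ideal A -> is_ideal J -> clos J = J ->
  localizing A -> ~ J x -> exists2 a, A a & ~ J (a * x).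
Proof.
move=> idA idJ cJ dA nJx; apply: contrapT => h; apply: nJx; rewrite -cJ.
apply: (localizing_clos idA) => // a Aa; apply: contrapT => nJ.
by apply: h; exists a.
Qed.

(** If the closure of [P] had an element [x] outside [P], then (P : x) would be in the system; being
    contained in [P], it would bring [P] along. *)
Lemma quasi_specP P : is_stable star -> quasi_spec star P <-> ~ localizing P.
Proof.
move=> stab; have idP := spec_ideal P; split=> [PE dP|ndP].
  by apply: (@spec_neq1 _ P); rewrite PE; apply/clos1.
apply/seteqP; split; first exact: sub_clos.
move=> x /(clos_localizing stab idP) dx; apply: contrapT => nPx; apply: ndP.
apply: localizing_sub dx => //; first exact: iquot_ideal.
by move=> d /= Pdx; apply: contrapT => /specM /(_ nPx).
Qed.

(** Since [L] has radical [Q], having 1 in Q^* forces 1 in L^*, while [L] is closed and proper. *)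
Lemma pseudo_spec_quasi_radical : is_quasi_radical star ->
  pseudo_spec star = set0.
Proof.
move=> qr; apply/seteqP; split=> // Q [dQ [L [[idL L1 _] rL LE]]].
apply: (qr L) => //; last by rewrite rL.
by move=> dL; apply: L1; rewrite LE; apply: (clos1 L).2.
Qed.

End Semistar.

(** * From localizing systems back to stable operations *)

Section LocalizingSystem.
Variables (D : idomainType) (F : set D -> Prop).
Hypothesis FT : F setT.
Hypothesis F0 : ~ F [set 0].
Hypothesis Fsub : forall A B, is_ideal A -> is_ideal B -> A `<=` B ->
  F A -> F B.
Hypothesis Ftrans : forall A L, is_ideal A -> is_ideal L -> F A ->
  (forall a, A a -> F (iquot L a)) -> F L.

Definition star_of (I : set {fraction D}) : set {fraction D} :=
  [set x | F (residual I x)].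

(** For [a] in [A], the quotient of the intersection by [a] contains [B]. *)
Lemma localizingI A B : is_ideal A -> is_ideal B -> F A -> F B -> F (A `&` B).
Proof.
move=> idA idB FA FB; have [A0 AD AM] := idA; have [B0 BD BM] := idB.
have idAB : is_ideal (A `&` B).
  split=> //.
  - by move=> x y [Ax Bx] [Ay By]; split; [apply: AD|apply: BD].
  - by move=> a x [Ax Bx]; split; [apply: AM|apply: BM].
apply: (Ftrans idA) => // a Aa; apply: (Fsub idB) => //;
  first exact: iquot_ideal.
by move=> b Bb; split; [apply: AM|apply: ideal_mull].
Qed.

Lemma star_of_ext A : star_of (ext A) 1 <-> F A.
Proof.
rewrite /star_of /=; have -> : residual (ext A) 1 = A => //.
by apply/seteqP; split=> x; rewrite /residual /= mulr1 extE.
Qed.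

(** [FT] gives extension, [Fsub] monotonicity, [Ftrans] idempotence and, through [localizingI],
    closure under sums. *)
Lemma star_of_semistar : is_semistar star_of.
Proof.
have subs I J x : is_submodule I -> is_submodule J -> residual I x `<=`
  residual J x ->
    star_of I x -> star_of J x.
  by move=> smI smJ; apply: Fsub; apply: residual_ideal.
have smS I : is_submodule I -> is_submodule (star_of I).
  move=> smI; have [I0 ID IM] := smI; split.
  - rewrite /star_of /=; suff -> : residual I 0 = setT by [].
    by apply/seteqP; split=> // d _; rewrite /residual /= mulr0.
  - move=> x y Fx Fy; have idx := residual_ideal x smI;
      have idy := residual_ideal y smI.
    apply: Fsub (localizingI idx idy Fx Fy); last 2 first.
    + exact: residual_ideal.
    + by move=> d [dx dy]; rewrite /residual /= mulrDr; apply: ID.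
    have [x0 xD xM] := idx; have [y0 yD yM] := idy; split=> //.
    + by move=> a b [ax ay] [bx by_]; split; [apply: xD|apply: yD].
    + by move=> a b [bx by_]; split; [apply: xM|apply: yM].
  - move=> a x Fx; apply: (Fsub (residual_ideal x smI)) Fx;
      first exact: residual_ideal.
    by move=> d; rewrite /residual /= mulrCA; apply: IM.
have extS I : is_submodule I -> I `<=` star_of I.
  move=> [_ _ IM] x Ix; rewrite /star_of /=;
    suff -> : residual I x = setT by [].
  by apply/seteqP; split=> // d _; apply: IM.
split=> //.
- by move=> I J smI smJ IJ x; apply: subs => // d; apply: IJ.
- move=> I smI; apply/seteqP; split; last exact/extS/smS.
  move=> x Fx; apply: (Ftrans _ _ Fx); try exact/residual_ideal/smI.
    exact/residual_ideal/smS.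
  move=> a Fax; suff -> : iquot (residual I x) a = residual I (tofrac a * x) by
    [].
  by apply/seteqP; split=> d; rewrite /iquot /residual /= tofracM mulrA.
- move=> x I smI; have [I0 _ _] := smI; have [->|x0] := eqVneq x 0.
    (* Scaling by 0 amounts to the zero module being closed, which is [F0]. *)
    have -> : [set 0 * y | y in star_of I] = [set 0].
      apply/seteqP; split=> [_ [y _ <-]|_ ->]; first by rewrite mul0r.
      by exists 0; rewrite ?mul0r //; apply: extS.
    have -> : [set 0 * y | y in I] = [set 0].
      by apply/seteqP; split=> [_ [y _ <-]|_ ->]; [rewrite mul0r|exists 0;
        rewrite ?mul0r].
    apply/seteqP; split=> [y|_ ->]; last first.
      rewrite /star_of /=; suff -> : residual [set 0] 0 = setT :> set D by [].
      by apply/seteqP; split=> // d _; rewrite /residual /= mulr0.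
    rewrite /star_of /=; apply: contraPP => /eqP y0.
    suff -> : residual [set 0] y = [set 0] :> set D by [].
    apply/seteqP; split=> [d|_ ->]; rewrite /residual /=;
      last by rewrite tofrac0 mul0r.
    by move=> /eqP; rewrite mulf_eq0 (negbTE y0) orbF tofrac_eq0 => /eqP.
  have E y : residual [set x * z | z in I] y = residual I (x^-1 * y).
    apply/seteqP; split=> d; rewrite /residual /=.
      by move=> [z Iz zE]; rewrite mulrCA -zE mulKf.
    by move=> Id; exists (tofrac d * (x^-1 * y)) => //; rewrite mulrCA mulVKf.
  apply/seteqP; split=> y; rewrite /star_of /= E.
    by move=> Fy; exists (x^-1 * y) => //; rewrite mulVKf.
  by move=> [z Fz <-]; rewrite mulKf.
Qed.

Lemma star_of_stable : is_stable star_of.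
Proof.
move=> I J smI smJ.
have E x : residual (I `&` J) x = residual I x `&` residual J x by [].
have id x := residual_ideal x (setI_submodule smI smJ).
apply/seteqP; split=> [x|x [FI FJ]]; rewrite /star_of /= E; last first.
  by apply: localizingI => //; apply: residual_ideal.
move=> FIJ.
by split; apply: (Fsub _ _ _ FIJ); try exact: residual_ideal;
  rewrite -?E // => d [].
Qed.

End LocalizingSystem.

(** * Spectral operations *)

Section Spectral.
Variables (D : idomainType) (star : set {fraction D} -> set {fraction D}).
Hypothesis starP : is_semistar star.
Implicit Types (A J L : set D) (I : set {fraction D}) (P Q : spec D).

(** Otherwise (I : x) is contained in [P], which would then be in the system. *)
Lemma star_sub_loc I P x : is_stable star -> is_submodule I ->
  quasi_spec star P -> star I x -> mulm I (loc P) x.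
Proof.
move=> stab smI /(quasi_specP starP _ stab).1 nd Ix; apply/mulm_locP => //.
apply: contrapT => h; apply: nd.
apply: (localizing_sub starP _ _ _ (star_localizing starP stab smI Ix)).
- exact: residual_ideal.
- exact: spec_ideal.
- by move=> s Is; apply: contrapT => Ps; apply: h; exists s.
Qed.

(** If [x] is not in I^*, then (I : x) is outside the system, and so is some prime [P] over it; then
    [x] is not in I D_P. *)
Lemma spectral_of_primes : is_stable star ->
    (forall J, is_ideal J -> ~ localizing star J ->
      exists2 P : spec D, J `<=` P & ~ localizing star P) ->
  is_spectral star.
Proof.
move=> stab enough; exists (quasi_spec star) => I smI.
apply/seteqP; split=> [x Ix P qP|x h]; first exact: star_sub_loc.
apply: contrapT => nIx; have idJ := residual_ideal x smI.
have [P JP /(quasi_specP starP _ stab).2 qP] : exists2 P : spec D,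
    residual I x `<=` P & ~ localizing star P.
  by apply: enough => // d; apply: nIx; apply: (localizing_star starP idJ).
by have /mulm_locP[//|s Ps /JP] := h P qP.
Qed.

Lemma spectral_prime J : is_spectral star -> is_ideal J -> ~ localizing star J
  ->
  exists2 P : spec D, J `<=` P & ~ localizing star P.
Proof.
move=> [Delta starE] idJ; have smJ := ext_submodule idJ.
rewrite {1}/localizing starE // => /existsNP[P /not_implyP[DP nJP]]; exists P.
  move=> j Jj; apply: contrapT => Pj; apply: nJP; apply/mulm_locP => //.
  by exists j; rewrite ?mulr1 //; exists j.
have smP := ext_submodule (spec_ideal P).
rewrite /localizing starE // => /(_ _ DP) /mulm_locP[//|s Ps].
by rewrite mulr1 => /extE.
Qed.

Lemma min_scattered_spectral :
  min_scattered D -> is_radical star -> is_spectral star.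
Proof.
move=> scatD [qrad stab]; apply: spectral_of_primes => // J idJ ndJ.
(* [R] contains [J], is closed and radical, and is proper by quasi-radicality. *)
have idrJ := rad_ideal idJ; set R := clos star (rad J).
have idR : is_ideal R by exact: clos_ideal.
have R1 : ~ R 1 by move/clos1; apply: qrad.
have radR x n : R (x ^+ n.+1) -> R x.
  move=> /(clos_localizing starP stab idrJ) dx.
  apply: (localizing_clos starP _ idrJ dx); first exact: iquot_ideal.
  move=> a; rewrite /iquot /= => -[m Jm].
  (* This power of [a * x] is a multiple of [(a * x ^+ n.+1) ^+ m.+1]; the predecessor offsets the
     successor in [rad]. *)
  exists (n.+1 * m.+1).-1%N; rewrite prednK ?muln_gt0 //.
  have -> : (a * x) ^+ (n.+1 * m.+1) =
      a ^+ (n * m.+1) * (a * x ^+ n.+1) ^+ m.+1.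
    by rewrite !exprMn -exprM mulrA -exprD addnC -mulSn.
  by case: idJ => _ _; apply.
have JR : J `<=` R.
  apply: subset_trans (sub_clos starP idrJ) => x Jx.
  by exists 0%N; rewrite expr1.
apply: contrapT => allP.
have dP P : R `<=` P -> localizing star P.
  by move=> RP; apply: contrapT => nd; apply: allP; exists P => //;
    apply: subset_trans RP.
have [P] := scattered_isolated (scatD R idR) (proper_min_prime idR R1).
move=> isoP; have [f Pf fP] := isolated_min_prime isoP.
have [RP _] := set_mem isoP.1.
apply/Pf/RP; rewrite /R -(closK starP idrJ).
apply: (localizing_clos starP (spec_ideal P) idR (dP P RP)) => p Pp.
(* A minimal prime of [R] contains [f] or equals [P], so it contains [p * f]. *)
have [n] : rad R (p * f); last exact: radR.
apply: radP => // Q /min_prime_below[Q' minQ' Q'Q]; apply: Q'Q.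
have [Q'f|Q'f] := pselect (spec_set Q' f).
  by case: (spec_ideal Q') => _ _; apply.
by rewrite (fP _ minQ' Q'f); apply: ideal_mull => //; apply: spec_ideal.
Qed.

End Spectral.

(** * A radical, non-spectral operation from a subspace without isolated points *)

Section NonScattered.
Variables (D : idomainType) (I : set D) (Y : set (spec D)).
Hypothesis YI : Y `<=` min_primes I.
Hypothesis Y0 : Y !=set0.
Hypothesis Yperfect : forall P, ~ isolated Y P.
Implicit Types (A L : set D) (P Q : spec D).

(** Encodes that the closed set V(A) has empty interior in [Y], tested on the basic open sets
    D(f). *)
Definition codense A : Prop := forall f, (exists2 P : spec D, Y P & ~ spec_set
  P f) ->
  exists P, [/\ Y P, ~ spec_set P f & ~ A `<=` P].

(** By minimality a point of [Y] over [Q] equals [Q], so a nonempty open set of such points would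
    isolate [Q] in [Y]. *)
Lemma codense_min_prime Q : min_primes I Q -> codense Q.
Proof.
move=> [IQ minQ] f [P YP Pf]; apply: contrapT => h.
have sub P' : Y P' -> ~ spec_set P' f -> P' = Q.
  move=> YP' P'f; apply: contrapT => P'Q; apply: h; exists P'; split=> // QP'.
  apply: P'Q; apply: spec_inj; case: (YI YP') => _ min'.
  by rewrite (min' Q).
apply: (@Yperfect P); split; first exact/mem_set.
exists [set P' : spec D | ~ spec_set P' f].
  rewrite nbhsE; exists [set P' : spec D | ~ spec_set P' f] => //.
  split=> //; exists [set f]; apply/seteqP; split=> P' /=.
    by move=> P'f /(_ f erefl).
  by move=> nS P'f; apply: nS => _ ->.
apply/seteqP; split=> [P' [P'f YP']|_ -> //].
by rewrite /= (sub P') // (sub P).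
Qed.

Lemma codense_star : exists star : set {fraction D} -> set {fraction D},
  [/\ is_semistar star, is_radical star & ~ is_spectral star].
Proof.
have FT : codense setT.
  by move=> f [P YP Pf]; exists P; split=> // /(_ 1 Logic.I) /spec_neq1.
have F0 : ~ codense [set 0].
  have [P YP] := Y0; move=> /(_ 1)[|P' [_ _]]; last first.
    by apply=> _ ->; case: (spec_ideal P').
  by exists P => //; apply: spec_neq1.
have Fsub A B : is_ideal A -> is_ideal B -> A `<=` B -> codense A -> codense B.
  move=> _ _ AB cA f /cA[P [YP Pf AP]]; exists P; split=> // BP.
  by apply: AP; apply: subset_trans BP.
have Ftrans A L : is_ideal A -> is_ideal L -> codense A ->
    (forall a, A a -> codense (iquot L a)) -> codense L.
  (* A point of D(f) omits some [a] in [A]; in the smaller open set D(fa) some point does not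
     contain (L : a), hence not [L]. *)
  move=> _ _ cA cL f /cA[P [YP Pf /existsNP[a /not_implyP[Aa Pa]]]].
  have [|P' [YP' P'fa LP']] := cL a Aa (f * a).
    by exists P => //; apply: specM.
  exists P'; split=> // [P'f|LP].
    by apply: P'fa; apply: ideal_mull => //; apply: spec_ideal.
  apply: LP' => d /LP /= P'da; apply: contrapT => P'd; apply: P'fa.
  case: (spec_prime P') => -[_ _ P'M] _ /(_ _ _ P'da)[//|P'a].
  exact: P'M.
have ss := star_of_semistar FT F0 Fsub Ftrans.
have dE A : localizing (star_of codense) A <-> codense A by apply: star_of_ext.
exists (star_of codense); split=> //.
  split; last exact: star_of_stable.
  move=> A idA; apply: contra_not => /dE cr; apply/dE => f /cr[P [YP Pf rP]].
  by exists P; split=> // AP; apply/rP/rad_spec.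
have [P0 YP0] := Y0; pose A := \bigcap_(P in Y) (P : set D).
have idA : is_ideal A.
  split=> [P _|x y Ax Ay P YP|a x Ax P YP];
    have [P0' PD PM] := spec_ideal P => //.
    by apply: PD; [apply: Ax|apply: Ay].
  by apply/PM/Ax.
move=> /spectral_prime /(_ idA)[|P AP].
  move/dE => /(_ 1)[|P' [YP' _ []]].
    by exists P0 => //; apply: spec_neq1.
  by move=> x; apply.
rewrite dE; apply.
have IP : I `<=` P.
  by apply: subset_trans AP => x Ix P' /YI[IP' _]; apply: IP'.
have [Q minQ QP] := min_prime_below IP.
by apply: (Fsub Q P) => //;
  [apply: spec_ideal|apply: spec_ideal|exact: codense_min_prime].
Qed.

End NonScattered.

(** * Pruefer domains *)

Section Prufer.
Variable D : idomainType.
Hypothesis pruD : is_prufer D.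
Implicit Types (A J L : set D) (I : set {fraction D}) (P Q N : spec D).

(* If [(a, b) B = D] then [1] is a sum of terms [c a u] or [c b u] with [u]
   in [B], so one of them lies outside [P]; for [t = c a u] one has
   [t b = (c b u) a] with [b u] in [D]. *)
Lemma prufer_valuation P a b : exists s c,
  ~ spec_set P s /\ (s * a = c * b \/ s * b = c * a).
Proof.
have [a0|a0] := eqVneq a 0.
  by exists 1, 0; split; [exact: spec_neq1|left; rewrite a0 mulr0 mul0r].
pose g (i : 'I_2) := if i == ord0 then a else b.
have spanE u v : ideal_span g (u * a + v * b).
  exists (fun i => if i == ord0 then u else v).
  by rewrite big_ord_recl big_ord1.
have ga : ideal_span g a by rewrite -[a]mul1r -[1 * a]addr0 -[0](mul0r b).
have gb : ideal_span g b by rewrite -[b]mul1r -[1 * b]add0r -[0](mul0r a).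
have [|B _ gBE] := @pruD _ g.
  by apply/eqP => gE; move: ga; rewrite gE /= => /eqP; apply/negP.
have inD x y : ideal_span g x -> B y -> exists d, tofrac d = tofrac x * y.
  move=> gx By; suff : ext setT (tofrac x * y) by case=> d _; exists d.
  rewrite -gBE; exists 1%N, (fun=> tofrac x), (fun=> y).
  by split=> //; [move=> _; exists x|rewrite big_ord1].
have : mulm (ext (ideal_span g)) B 1 by rewrite gBE; exists 1; rewrite ?tofrac1.
move=> [n [x [y [gx By oneE]]]]; apply: contrapT => noval.
suff : ext (P : set D) 1 by rewrite -tofrac1 => /extE /spec_neq1.
rewrite oneE; have [P0 PD PM] := spec_ideal P; apply: big_ind.
- by exists 0; rewrite ?tofrac0.
- by move=> _ _ [u Pu <-] [v Pv <-]; exists (u + v); rewrite ?tofracD //;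
    apply: PD.
move=> i _; have [_ [c ->] <-] := gx i.
have [u uE] := inD a (y i) ga (By i); have [v vE] := inD b (y i) gb (By i).
exists (c ord0 * u + c (lift ord0 ord0) * v); last first.
  rewrite tofracD !tofracM uE vE big_ord_recl big_ord1 /g /= tofracD !tofracM.
  by rewrite mulrDl -!mulrA.
have uvE : u * b = v * a.
  apply/eqP; rewrite -tofrac_eq !tofracM uE vE.
  by rewrite mulrAC [eqbRHS]mulrAC [tofrac a * _]mulrC.
apply: PD; apply/PM; apply: contrapT => Pn; apply: noval.
  by exists u, v; split=> //; right.
by exists v, u; split=> //; left.
Qed.

(** The contraction to [D] of J D_Q. *)
Definition saturation J Q : set D :=
  [set d | exists2 s, ~ spec_set Q s & J (s * d)].

Lemma saturation_ideal J Q : is_ideal J -> is_ideal (saturation J Q).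
Proof.
move=> [J0 JD JM]; split.
- by exists 1; [exact: spec_neq1|rewrite mulr0].
- move=> x y [s Qs Jsx] [t Qt Jty]; exists (s * t); first exact: specM.
  have -> : s * t * (x + y) = t * (s * x) + s * (t * y) by ring.
  by apply: JD; apply/JM.
- by move=> a x [s Qs Jsx]; exists s => //; rewrite mulrCA; apply: JM.
Qed.

Lemma saturation_unit J Q s d : saturation J Q (s * d) -> ~ spec_set Q s ->
  saturation J Q d.
Proof.
move=> [t Qt Jtsd] Qs; exists (t * s); first exact: specM.
by rewrite -mulrA.
Qed.

(** Suppose [Q] is in the pseudo-spectrum and [y] maps I D_Q into D_Q, but xy is not in D_Q. In the
    valuation domain D_Q this gives xy = t/c with [c] in [Q] and [t] outside, so (I : x) lies in c
    D_Q. Powers of [c] then put 1 in L^*. *)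
Lemma star_sub_normalized star I : is_semistar star -> is_stable star ->
  is_submodule I -> star I `<=` normalized_stable star I.
Proof.
move=> starP stab smI x Ix; split=> [P qP|Q psQ];
  first exact: (star_sub_loc starP stab smI qP Ix).
have [dQ [L [[idL L1 Lprim] radL LE]]] := psQ.
move=> _ [y yIV <-]; apply: contrapT => nV; apply: L1; rewrite LE;
  apply: (clos1 star L).2.
have idJ := residual_ideal x smI; have dJ := star_localizing starP stab smI Ix.
have [u [v [v0 xyE]]] := fraction_quotient (x * y).
have [t [c [Qt]]] := prufer_valuation Q u v.
have t0 := spec_tofrac_neq0 Qt; have fv0 : tofrac v != 0 by rewrite tofrac_eq0.
case=> [tuE|tvE].
  case: nV; rewrite xyE; apply/locP; exists t => //; exists c.
  by rewrite mulrA -tofracM tuE tofracM mulfK.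
have cu0 : tofrac c * tofrac u != 0 by rewrite -!tofracM -tvE tofracM mulf_neq0.
have xyE' : x * y = tofrac t / tofrac c.
  have [c0 u0] : tofrac c != 0 /\ tofrac u != 0.
    by move: cu0; rewrite mulf_eq0 negb_or => /andP.
  rewrite xyE; apply: (mulIf fv0); rewrite divfK // mulrAC -tofracM tvE tofracM.
  by rewrite mulrC mulKf.
have Qc : spec_set Q c.
  apply: contrapT => Qc; apply: nV; apply/locP; exists c => //; exists t.
  by rewrite xyE' mulrC divfK //; apply: spec_tofrac_neq0 Qc.
have c0 : tofrac c != 0 by move: cu0; rewrite mulf_eq0 negb_or => /andP[].
(* [A k] is the contraction of c^k D_Q. *)
pose A k := [set d | exists2 s, ~ spec_set Q s & exists e, s * d = c ^+ k * e].
have idA k : is_ideal (A k).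
  split; first by exists 1; [exact: spec_neq1|exists 0; rewrite !mulr0].
    move=> d d' [s Qs [e E]] [s' Qs' [e' E']]; exists (s * s');
      first exact: specM.
    exists (s' * e + s * e').
    have -> : s * s' * (d + d') = s' * (s * d) + s * (s' * d') by ring.
    by rewrite E E'; ring.
  by move=> a d [s Qs [e E]]; exists s => //; exists (a * e); rewrite mulrCA E;
    ring.
have JA j : residual I x j ->
    exists2 s, ~ spec_set Q s & exists e, s * j = c * e.
  move=> Ij; have : loc Q (y * (tofrac j * x)).
    by apply: yIV; exists (tofrac j * x) => //; apply/mulm_locP => //; exists 1;
       rewrite ?tofrac1 ?mul1r //; apply: spec_neq1.
  move=> /locP[s Qs [e E]]; exists (s * t); first exact: specM.
  exists e; apply/eqP; rewrite -tofrac_eq !tofracM -E; apply/eqP.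
  have -> : y * (tofrac j * x) = tofrac j * (x * y).
    by rewrite mulrCA [y * x]mulrC.
  rewrite xyE'; have fieldE (K : fieldType) (p q r z : K) :
      z != 0 -> p * q * r = z * (p * (r * (q / z))) by move=> ?; field.
  exact: fieldE.
have dA k : localizing star (A k).
  elim: k => [|k IH].
    apply: (localizing_sub starP (@idealT D)) (localizingT starP) => // d _.
    by exists 1; [exact: spec_neq1|exists d; rewrite expr0].
  (* The product of (I : x) and [A k] lies in [A k.+1], so (I : x) lies in the closure of
     [A k.+1]. *)
  apply: (localizing_trans starP idJ) => // j /JA[s Qs [e E]].
  apply: (localizing_clos starP (idA k)) => // d [s' Qs' [e' E']].
  exists (s' * s); first exact: specM.
  exists (e' * e); have -> : s' * s * (d * j) = (s' * d) * (s * j) by ring.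
  by rewrite E E' exprS; ring.
have [n Lc] : rad L c by rewrite radL.
apply: (localizing_sub starP (idA n.+1)) (dA n.+1) => // d [s Qs [e E]].
have /Lprim[//|[m Lsm]] : L (d * s) by rewrite mulrC E; apply: ideal_mull.
by case: Qs; apply: (@spec_exp _ _ _ m.+1); rewrite -radL; exists 0%N;
  rewrite expr1.
Qed.

(** If the saturation [L] were outside the system, its closure would be [Q]-primary and [Q] in the
    pseudo-spectrum. Choose [a] in [Q] outside [L]; then [J] lies in a D_Q, so I D_Q lies in ax D_Q,
    and the v-closure at [Q] yields 1/a in D_Q. *)
Lemma localizing_saturation star I x Q (J := clos star (residual I x)) :
    is_semistar star -> is_stable star -> is_submodule I ->
    ~ star I x -> normalized_stable star I x -> min_primes J Q ->
    localizing star Q ->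
  localizing star (saturation J Q).
Proof.
move=> starP stab smI nIx [_ Ix] minQ dQ; apply: contrapT => ndL.
have idR := residual_ideal x smI; have RJ := sub_clos starP idR.
have idJ : is_ideal J by exact: clos_ideal.
have JQ : J `<=` Q by case: minQ.
set L := saturation J Q in ndL;
  have idL : is_ideal L by exact: saturation_ideal.
(* For [s] outside [Q], (L : ds) is contained in (L : d). *)
have cloL s d : clos star L (d * s) -> ~ spec_set Q s -> clos star L d.
  move=> /(clos_localizing starP stab idL) dd Qs.
  apply: (localizing_clos starP _ idL dd); first exact: iquot_ideal.
  by move=> a; rewrite /iquot /= mulrA mulrC => /saturation_unit; apply.
have powL q : spec_set Q q -> exists n, L (q ^+ n.+1).
  by move=> /(min_prime_power idJ minQ)[s [n [Qs Js]]]; exists n, s.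
have cL1 : ~ clos star L 1 by move/clos1.
have psQ : pseudo_spec star Q.
  split=> //; exists (clos star L); split; last by rewrite -/(clos _ _) closK.
    split=> //; first exact: clos_ideal.
    move=> a b Lab; have [Qb|Qb] := pselect (spec_set Q b).
      by right; have [n Ln] := powL b Qb; exists n; apply: sub_clos.
    by left; apply: cloL Lab Qb.
  apply/seteqP; split=> [c [n Lc]|c /powL[n Lc]]; last by exists n;
    apply: sub_clos.
  apply: contrapT => Qc; apply: cL1; apply: (cloL (c ^+ n.+1));
    first by rewrite mul1r.
  by move/spec_exp.
have [a [Qa La]] : exists a, spec_set Q a /\ ~ L a.
  apply: contrapT => h; apply: ndL.
  apply: (localizing_sub starP (spec_ideal Q) idL) dQ => q Qq.
  by apply: contrapT => Lq; apply: h; exists q.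
have Ja j : J j -> exists s c, ~ spec_set Q s /\ s * j = c * a.
  move=> Jj; have [s [c [Qs [E|E]]]] := prufer_valuation Q j a;
    first by exists s, c.
  by case: La; exists s => //; rewrite E; case: idJ => _ _; apply.
have a0 : tofrac a != 0.
  by rewrite tofrac_eq0; apply: contra_notN La => /eqP ->; case: idL.
have x0 : x != 0.
  by apply: contra_notN nIx => /eqP ->; case: (semistar_submodule starP smI).
have /(_ Q psQ) vx := Ix.
(* This element is 1/a, which is not in D_Q because [a] is in [Q]. *)
have : loc Q (x * (tofrac a * x)^-1); last first.
  rewrite invfM mulrCA mulfV // mulr1.
  move=> /locP[s Qs [d E]]; apply: Qs.
  have -> : s = d * a by apply/eqP;
    rewrite -tofrac_eq tofracM -E mulrVK ?unitfE.
  by case: (spec_ideal Q) => _ _; apply.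
apply: vx; exists (tofrac a * x)^-1 => //.
move=> _ [z /mulm_locP -/(_ smI)[s Qs Isz] <-].
have s0 := spec_tofrac_neq0 Qs.
have [u [v [v0 iE]]] := fraction_quotient (tofrac s * z / x).
have fv0 : tofrac v != 0 by rewrite tofrac_eq0.
have izE : tofrac s * z * tofrac v = tofrac u * x.
  by rewrite -[tofrac s * z](divfK x0) iE mulrAC divfK.
have [t [c [Qt]]] := prufer_valuation Q u v; have t0 := spec_tofrac_neq0 Qt.
have RI d : I (tofrac d * x) -> J d by move=> Id; apply: RJ.
have IM d i : I i -> I (tofrac d * i) by case: smI => _ _; apply.
case=> [tuE|tvE].
  have tzE : tofrac t * (tofrac s * z) = tofrac c * x.
    apply: (mulIf fv0); rewrite -mulrA izE mulrA -tofracM tuE tofracM.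
    by rewrite mulrAC.
  have [|s' [d [Qs' E]]] := Ja c; first by apply: RI; rewrite -tzE; apply: IM.
  apply/locP; exists (s' * (t * s)); first by do 2?apply: specM.
  exists d; rewrite !tofracM.
  have -> : tofrac s' * (tofrac t * tofrac s) * ((tofrac a * x)^-1 * z) =
    tofrac s' * (tofrac t * (tofrac s * z)) / (tofrac a * x).
    by rewrite [_^-1 * z]mulrC -!mulrA.
  by rewrite tzE mulrA -tofracM E tofracM -(mulrA (tofrac d)) mulfK ?mulf_neq0.
(* In the other case tx lies in [I], which puts [t] in [J] and so in [Q]. *)
case: Qt; apply/JQ/RI.
have u0 : tofrac u != 0.
  apply: contraTneq (mulf_neq0 t0 fv0) => u0.
  by rewrite -tofracM tvE tofracM u0 mulr0 eqxx.
suff -> : tofrac t * x = tofrac c * (tofrac s * z) by apply: IM.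
apply: (mulfI u0); rewrite mulrCA -izE mulrCA.
have -> : tofrac u * (tofrac c * (tofrac s * z)) =
    tofrac (c * u) * (tofrac s * z).
  by rewrite tofracM mulrCA mulrA.
by rewrite -tvE tofracM [RHS]mulrC.
Qed.

End Prufer.

(** * The radical localizing system attached to a proper ideal *)

Section Comaximal.
Variables (D : idomainType) (J : set D).
Hypotheses (idJ : is_ideal J) (J1 : ~ J 1).
Implicit Types (A L : set D) (P Q : spec D).

Definition comaximal A : Prop := forall x, ~ J x ->
  exists y, ~ J (y * x) /\
    exists a j, [/\ A a, J (j * (y * x)) & a + j = 1].

Lemma comaximalT : comaximal setT.
Proof.
move=> x Jx; exists 1; rewrite mul1r; split=> //; exists 1, 0.
by rewrite mul0r addr0; split=> //; case: idJ.
Qed.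

Lemma comaximalS A L : A `<=` L -> comaximal A -> comaximal L.
Proof.
move=> AL cA x /cA[y [Jyx [a [j [Aa Jj aj1]]]]]; exists y; split=> //.
by exists a, j; split=> //; apply: AL.
Qed.

(** At [x = 1] both summands of y = ay + jy lie in [J]. *)
Lemma comaximalN : ~ comaximal J.
Proof.
have [_ JD JM] := idJ; move=> /(_ 1 J1)[y [Jy [a [j [Ja Jj aj1]]]]]; apply: Jy.
by have := JD _ _ (ideal_mull (y * 1) idJ Ja) Jj; rewrite -mulrDl aj1 mul1r.
Qed.

Lemma comaximal_trans A L : is_ideal A -> is_ideal L -> comaximal A ->
  (forall a, A a -> comaximal (iquot L a)) -> comaximal L.
Proof.
have [_ JD JM] := idJ; move=> _ _ cA cL x /cA[y [Jyx [a [j [Aa Jj aj1]]]]].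
(* The element [a * (y * x)] is outside [J], since it differs from [y * x] by [j * (y * x)]. *)
have [|z [Jz [l [t [Ll Jt lt1]]]]] := cL a Aa (a * (y * x)).
  by move=> Ja; apply: Jyx; have := JD _ _ Ja Jj; rewrite -mulrDl aj1 mul1r.
exists (z * (a * y)); have E : z * (a * y) * x = z * (a * (y * x)) by ring.
rewrite E; split=> //; exists (l * a), (t * a + j); split=> //.
  have -> : (t * a + j) * (z * (a * (y * x))) =
    a * (t * (z * (a * (y * x)))) + z * a * (j * (y * x)) by ring.
  by apply: JD; apply/JM.
by rewrite addrA -mulrDl lt1 mul1r.
Qed.

(** With r + j = 1, the element [j] divides [1 - r ^+ n.+1]. *)
Lemma comaximal_rad A : comaximal (rad A) -> comaximal A.
Proof.
move=> cA x /cA[y [Jyx [r [j [[n An] Jj rj1]]]]]; exists y; split=> //.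
exists (r ^+ n.+1), (1 - r ^+ n.+1); split=> //; last by rewrite addrC subrK.
have -> : 1 - r ^+ n.+1 = (\sum_(i < n.+1) r ^+ i) * j.
  by rewrite -opprB subrX1 -rj1; ring.
by rewrite -mulrA; case: idJ => _ _; apply.
Qed.

Lemma comaximal_star : exists star : set {fraction D} -> set {fraction D},
  [/\ is_semistar star, is_radical star &
      forall A, localizing star A <-> comaximal A].
Proof.
have F0 : ~ comaximal [set 0].
  by move/(@comaximalS _ J) => h; apply/comaximalN/h => _ ->; case: idJ.
have Fsub A B : is_ideal A -> is_ideal B -> A `<=` B -> comaximal A ->
  comaximal B.
  by move=> _ _; apply: comaximalS.
have dE A : localizing (star_of comaximal) A <-> comaximal A.
  exact: star_of_ext.
exists (star_of comaximal); split=> //.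
  exact: star_of_semistar comaximalT F0 Fsub comaximal_trans.
split; last exact: star_of_stable Fsub comaximal_trans.
by move=> A idA; apply: contra_not => /dE /comaximal_rad /dE.
Qed.

(* For [c] in [J D_Q] and [q] in [Q], the ideal [(J : c q)] lies in no prime
   containing [Q]: above [Q] the localizations are valuation domains, so that
   [s c \in J] with [s] outside [Q] gives [c q \in J]. *)
Lemma comaximal_spec star Q : is_prufer D -> is_semistar star ->
    clos star J = J -> localizing star Q -> localizing star (saturation J Q) ->
  comaximal Q.
Proof.
move=> pruD starP cJ dQ dL x Jx; have idQ := spec_ideal Q.
have [c [s Qs Jsc] Jcx] :=
  closed_mulN starP (saturation_ideal Q idJ) idJ cJ dL Jx.
have [q Qq Jqcx] := closed_mulN starP idQ idJ cJ dQ Jcx.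
exists (q * c); rewrite -mulrA; split=> //.
apply: contrapT => nsum.
pose A := [set z | exists a j,
  [/\ spec_set Q a, J (j * (q * (c * x))) & a + j = z]].
have [[Q0 QD QM] [J0 JD JM]] := (idQ, idJ).
have idA : is_ideal A.
  split.
  - by exists 0, 0; rewrite mul0r addr0.
  - move=> _ _ [a [j [Qa Jj <-]]] [b [k [Qb Jk <-]]].
    by exists (a + b), (j + k); split; [exact: QD|rewrite mulrDl;
      apply: JD|ring].
  - move=> d _ [a [j [Qa Jj <-]]].
    by exists (d * a), (d * j); split; [exact: QM|rewrite -mulrA;
      apply: JM|ring].
have [N [AN _]] := proper_min_prime idA nsum.
have QN a : spec_set Q a -> spec_set N a.
  by move=> Qa; apply: AN; exists a, 0; rewrite mul0r addr0.
(* Either [t] multiplies qcx into [J], so lies in [N], or [t * s] lies in [Q] with both factors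
   outside. *)
have [t [e [Nt [tqE|tsE]]]] := prufer_valuation pruD N q s.
  apply/Nt/AN; exists 0, t; rewrite add0r; split=> //.
  have -> : t * (q * (c * x)) = (t * q) * (c * x) by ring.
  rewrite tqE; have -> : e * s * (c * x) = e * x * (s * c) by ring.
  exact: JM.
apply: (@specM _ Q t s) => //; first by move/QN.
by rewrite tsE; apply: QM.
Qed.

End Comaximal.

Lemma normalized_sub_star (D : idomainType)
    (star : set {fraction D} -> set {fraction D}) (I : set {fraction D}) :
    is_prufer D ->
    (forall star : set {fraction D} -> set {fraction D},
      is_semistar star -> is_radical star -> is_spectral star) ->
    is_semistar star -> is_stable star -> is_submodule I ->
  normalized_stable star I `<=` star I.
Proof.
move=> pruD radsp starP stab smI x Ix; apply: contrapT => nIx.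
have idR := residual_ideal x smI; set J := clos star (residual I x).
have idJ : is_ideal J by exact: clos_ideal.
have J1 : ~ J 1.
  by move=> /(clos1 star _).1 dR; apply: nIx;
    apply: (localizing_star starP idR).
have [star' [starP' rad' dE]] := comaximal_star idJ J1.
have [|P JP] := @spectral_prime _ _ J (radsp star' starP' rad') idJ.
  by move/dE; apply: comaximalN.
move=> /dE; apply; have [Q minQ QP] := min_prime_below JP.
(* Were [Q] outside the system of [star], it would be in the quasi-spectrum, and [x] in I D_Q would
   give an element of [J] outside [Q]. *)
apply: (comaximalS QP); have dQ : localizing star Q.
  apply: contrapT => /(quasi_specP starP _ stab).2 qQ;
    case: Ix => /(_ Q qQ) + _.
  move=> /mulm_locP[//|s Qs Isx]; apply: Qs; case: minQ => JQ _.
  by apply/JQ/(sub_clos starP).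
apply: (comaximal_spec idJ pruD starP _ dQ); first exact: closK.
exact: localizing_saturation.
Qed.

Theorem theorem6p7 (D : idomainType) (D_prufer : is_prufer D) :
  [<-> min_scattered D;
       forall star : set {fraction D} -> set {fraction D},
         is_semistar star -> is_radical star -> is_spectral star;
       forall star : set {fraction D} -> set {fraction D},
         is_semistar star -> is_stable star ->
         forall I : set {fraction D}, is_submodule I ->
           star I = normalized_stable star I].
Proof.
split; first by move=> scatD star starP; apply: min_scattered_spectral.
split=> [radsp star starP stab I smI|norm A idA].
  apply/seteqP; split; first exact: star_sub_normalized.
  exact: normalized_sub_star.
apply: isolated_scattered => Y YA Y0; apply: contrapT => noiso.
have [|star [starP [qrad stab]]] := codense_star YA Y0.
  by move=> P isoP; apply: noiso; exists P.
(* With empty pseudo-spectrum, the normalization is the spectral operation of the quasi-spectrum. *)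
apply; exists (quasi_spec star) => I smI.
rewrite (norm star starP stab I smI) /normalized_stable.
by rewrite (pseudo_spec_quasi_radical qrad) bigcap_set0 setIT.
Qed.
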